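(* If $\mathbb E S_N<0$ and $s\in\mathbb C$ is such that $|s|\le1$ and $s\ne0$, then $$(1-s)\sum_{j=1}^{N}s^{m_j}\,H_j(s)\sum_{i=0}^{-m_j-1}\pi_i^{(j+1)}\sum_{r=0}^{-m_j-1-i}s^{r+i}F_{X_j}(m_j+r)=G_{\mathcal M_N}(s)\big(G_{S_N}(s)-1\big),$$ where $H_N(s):=1$ and, for $1\le j\le N-1$, $H_j(s):=G_{X_N+X_1+\cdots+X_{j-1}}(s)$ (so that $H_1(s)=G_{X_N}(s)$ when $N\ge2$), and $\pi^{(N+1)}=\pi^{(1)}$. Moreover, $$\sum_{j=1}^{N}\sum_{i=0}^{-m_j-1}\pi_i^{(j+1)}\sum_{r=0}^{-m_j-1-i}F_{X_j}(m_j+r)=-\mathbb E S_N.$$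
   Context: Let $N\in\mathbb N$ and let $X_1,X_2,\ldots$ be independent integer-valued random variables that are $N$-periodic in distribution: $X_k$ and $X_{k+N}$ have the same distribution for all $k\in\mathbb N$. For $j=1,\ldots,N$ the support of $X_j$ starts at $m_j\in\mathbb Z$, i.e. $\mathbb P(X_j=m_j)>0$ and $\mathbb P(X_j\ge m_j)=1$, and $m_1+\cdots+m_N<0$ (the individual $m_j$ may have any sign). Put $S_N:=X_1+\cdots+X_N$ and $F_{X_j}(k):=\mathbb P(X_j\le k)$. For $j=1,\ldots,N$ let $\mathcal M_j:=\max\{0,\,X_j,\,X_j+X_{j+1},\,X_j+X_{j+1}+X_{j+2},\ldots\}$ (supremum over all partial sums started at index $j$) and $\pi^{(j)}_k:=\mathbb P(\mathcal M_j=k)$, $k\in\mathbb N_0=\{0,1,2,\ldots\}$. For an integer-valued random variable $X$ with $\mathbb P(m\le X<\infty)=1$, its probability generating function is $G_X(s)=\sum_{k=m}^\infty s^k\,\mathbb P(X=k)$ for $s\in\mathbb C$, $|s|\le1$, and $s\ne0$ if $m<0$. Empty sums are $0$ (the sum over $i$ from $0$ to $-m_j-1$ is $0$ when $m_j\ge0$). *)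

(* Defs.v *)
From HB Require Import structures.
From mathcomp Require Import all_boot all_order all_algebra finmap complex.
From mathcomp Require Import all_classical all_reals all_analysis.

Set Implicit Arguments.
Unset Strict Implicit.
Unset Printing Implicit Defensive.

Import Order.TTheory GRing.Theory Num.Theory.
Import numFieldNormedType.Exports.

Local Open Scope classical_set_scope.
Local Open Scope ring_scope.
Local Open Scope complex_scope.

Section RandomWalk.
Context {d : measure_display} {T : measurableType d} {R : realType}.
Variable P : probability T R.

Definition mutually_independent (I : set nat) (X : nat -> {RV P >-> R}) : Prop :=
  forall (J : {fset nat}) (B : nat -> set R),
    (forall k, k \in J -> I k) ->
    (forall k, k \in J -> measurable (B k)) ->
    P (\bigcap_(k in [set` J]) (X k @^-1` B k)) =
    (\prod_(k <- J) P (X k @^-1` B k))%E.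

Definition same_distribution (X Y : {RV P >-> R}) : Prop :=
  forall A : set R, measurable A -> distribution P X A = distribution P Y A.

(* [m] is an almost sure lower bound of [X]; the value does not depend on
   its choice. [X] may be extended-real so that suprema of walks, which are
   finite only almost surely, are covered. *)
Definition pgf (m : int) (X : T -> \bar R) (s : R[i]) : R[i] :=
  limn (fun n : nat => \sum_(0 <= k < n)
    s ^ (m + k%:Z) * (fine (P [set t | X t = (m + k%:Z)%:~R%:E]))%:C : R[i]^o).

Definition cdf_at (X : {RV P >-> R}) (k : int) : R := fine (cdf X k%:~R).

Variable X : nat -> {RV P >-> R}.

(* The empty sum ([n = 0]) supplies the value 0 in the maximum. *)
Definition walk_sup (j : nat) (t : T) : \bar R :=
  ereal_sup [set (\sum_(j <= k < j + n) X k t)%:E | n in [set: nat]].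

Definition walk_sup_pmf (j k : nat) : R :=
  fine (P [set t | walk_sup j t = k%:R%:E]).

Variables (N : nat) (m : nat -> int).

(* The convention pi^(N+1) = pi^(1). *)
Definition pi_succ (j : nat) : nat -> R :=
  walk_sup_pmf (if j == N then 1%N else j.+1).

Definition period_sum (t : T) : R := \sum_(1 <= k < N.+1) X k t.

Definition pgf_prefix (j : nat) (s : R[i]) : R[i] :=
  if j == N then 1 else
  pgf (m N + \sum_(1 <= k < j) m k)
      (fun t => (X N t + \sum_(1 <= k < j) X k t)%:E) s.

(* The natural number max(0, - z), the number of terms of the sum over
   0 <= i <= - z - 1. *)
Definition neg_part (z : int) : nat := absz (Num.max 0 (- z)).

End RandomWalk.

(* Main.v *)
Require Import Defs.
From HB Require Import structures.
From mathcomp Require Import all_boot all_order all_algebra finmap complex.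
From mathcomp Require Import all_classical all_reals all_analysis.
From mathcomp Require Import measurable_realfun.
From mathcomp Require Import zify ring lra.
Import Order.TTheory GRing.Theory Num.Theory.
Import numFieldNormedType.Exports.
Local Open Scope classical_set_scope.
Local Open Scope ring_scope.
Local Open Scope complex_scope.

Set Implicit Arguments.
Unset Strict Implicit.
Unset Printing Implicit Defensive.

(* M_j = max(0, X_j + M_(j+1)) with M_(j+1) independent of X_j. Splitting off the event
   X_j + M_(j+1) < 0 gives
     G_(M_j) = G_(X_j) G_(M_(j+1)) - (1 - s) s^(m_j) D_j(s),
   with D_j the inner double sum of the statement, and multiplying these relations along one
   period, starting from M_N and using that M_(N+1) and M_1 have the same law, yields the first
   identity. It holds even if M_j is infinite with positive probability, as that event carries no
   term of G_(M_j).
   For the second identity, write L = sum_j E[max(0, - (X_j + M_(j+1)))] and sum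
   E[min(M_j, K)] - E[min(M_(j+1), K)] over one period: the total is 0, and letting K tend to
   infinity gives L = - p E S_N with p = P(M < oo). The same computation for the maxima over a
   finite horizon, which are almost surely finite and increase with the horizon, gives
   L >= - E S_N. As p <= 1 and E S_N < 0, this forces L = - E S_N. *)

(** * Convolutions of sequences and their limits *)

(** The Cauchy product. It is used with [a] a mass function and [b] either a mass function or a
    distribution function; the result is then of the same kind as [b], for the sum of independent
    variables. *)
Definition conv {R : pzSemiRingType} (a b : nat -> R) (n : nat) : R :=
  \sum_(0 <= l < n.+1) a l * b (n - l)%N.

Lemma convC (R : comPzSemiRingType) (a b : nat -> R) n :
  conv a b n = conv b a n.
Proof.
rewrite /conv big_nat_rev /= add0n; apply: eq_big_nat => l /andP[_].
by rewrite ltnS subSS => ln; rewrite subKn // mulrC.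
Qed.

(** Cumulation may be applied to one factor only. The shift is there because [series b k.+1] sums up
    to index [k] inclusive. *)
Lemma series_conv (R : comPzRingType) (a b : nat -> R) n :
  series (conv a b) n.+1 = conv a (fun k => series b k.+1) n.
Proof.
elim: n => [|n IH]; first by rewrite /series /conv /= !(big_nat1, subnn).
rewrite seriesSr IH /conv !(big_nat_recr n.+1) //= addrA -big_split /=.
congr (_ + _); last first.
  by rewrite subnn /series /= big_nat1.
apply: eq_big_nat => l /andP[_ ln].
by rewrite -mulrDr subSn // [in RHS]seriesSr.
Qed.

Lemma conv_ge0 (R : numDomainType) (a b : nat -> R) n :
  (forall k, 0 <= a k) -> (forall k, 0 <= b k) -> 0 <= conv a b n.
Proof. by move=> a0 b0; apply: sumr_ge0 => l _; rewrite mulr_ge0. Qed.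

Lemma half_cvgn : half n @[n --> \oo] --> \oo.
Proof.
apply/cvgnyPge => A; exists (A.*2) => //= n /= An.
by rewrite geq_half_double.
Qed.

Lemma cvg_sum_nat (R : realType) (F : nat -> nat -> R) (l : nat -> R) (a b : nat) :
  (forall i, (a <= i < b)%N -> F i n @[n --> \oo] --> l i) ->
  \sum_(a <= i < b) F i n @[n --> \oo] --> \sum_(a <= i < b) l i.
Proof.
elim: b => [|b IH] Fl.
  by under eq_cvg do rewrite big_geq //; rewrite big_geq //; exact: cvg_cst.
have [ab|ba] := leqP a b; last first.
  by under eq_cvg do rewrite big_geq //; rewrite big_geq //; exact: cvg_cst.
under eq_cvg do rewrite big_nat_recr //.
rewrite big_nat_recr //=; apply: cvgD; last by apply: Fl; rewrite ab ltnSn.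
by apply: IH => i /andP[ai ib]; apply: Fl; rewrite ai ltnW.
Qed.

(* Squeezed between [u (n / 2) * series t (n / 2)] and [u n * series t (n + 1)]. *)
Lemma cvg_conv (R : realType) (t u : nat -> R) (e p : R) :
  (forall k, 0 <= t k) -> (forall k, 0 <= u k) ->
  {homo u : m n / (m <= n)%N >-> m <= n} ->
  series t @ \oo --> e -> u @ \oo --> p -> conv t u @ \oo --> e * p.
Proof.
move=> t0 u0 u_nd te up.
apply: (@squeeze_cvgr _ _ _ _ (fun n => series t n./2 * u n./2)
  (fun n => series t n.+1 * u n)).
- near=> n; apply/andP; split.
    rewrite /conv (big_cat_nat (leq0n n./2)); last by lia.
    rewrite /= -[leLHS]addr0 lerD //; last by apply: sumr_ge0 => i _; rewrite mulr_ge0.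
    rewrite /series/= mulr_suml; apply: ler_sum_nat => l /andP[_ ln].
    by rewrite ler_wpM2l // u_nd //; lia.
  rewrite /series/= mulr_suml; apply: ler_sum_nat => l _.
  by rewrite ler_wpM2l // u_nd // leq_subr.
- by apply: cvgM; apply: (cvg_comp _ _ half_cvgn).
- by apply: cvgM => //; rewrite (cvg_shiftS (series t)).
Unshelve. all: by end_near. Qed.

(** By [series_conv] the partial sums are [a] convolved with the nondecreasing partial sums of [b],
    so [cvg_conv] applies. *)
Lemma cvg_series_conv (R : realType) (a b : nat -> R) (x y : R) :
  (forall k, 0 <= a k) -> (forall k, 0 <= b k) ->
  series a @ \oo --> x -> series b @ \oo --> y ->
  series (conv a b) @ \oo --> x * y.
Proof.
move=> a0 b0 ax byy; rewrite -(cvg_shiftS (series (conv a b))) /=.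
rewrite (_ : (fun n => _) = conv a (fun k => series b k.+1)); last first.
  by apply/funext => n; rewrite series_conv.
apply: cvg_conv => //.
- by move=> k; apply: sumr_ge0.
- by move=> i j ij; apply: nondecreasing_series => //; rewrite ltnS.
- by rewrite (cvg_shiftS (series b)).
Qed.

(** * Complex generating functions on the closed unit disc *)

Lemma cvg_real_complex (R : realType) (u : nat -> R) (x : R) :
  u @ \oo --> x -> ((u n)%:C : R[i]^o) @[n --> \oo] --> (x%:C : R[i]^o).
Proof.
move=> /cvgrPdist_lt ux; apply/cvgrPdist_lt => e e0.
(* A positive element of [R[i]] has zero imaginary part, so the radius [e] is real. *)
have eE : e = (complex.Re e)%:C.
  by move: e0; case: e => er ei /=; rewrite ltcE /= => /andP[/eqP-> _].
have re0 : 0 < complex.Re e by move: e0; rewrite eE ltcR.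
apply: filterS (ux _ re0) => n.
by rewrite -rmorphB normc_def /= expr0n addr0 sqrtr_sqr eE ltcR.
Qed.

(** The real and imaginary parts are dominated by [q], hence converge absolutely in [R]; the complex
    series is reassembled from them. *)
Lemma cvg_series_complex (R : realType) (q : nat -> R) (u : nat -> R[i]) :
  cvgn (series q) -> (forall k, `|u k| <= (q k)%:C) ->
  cvgn (series u : nat -> R[i]^o).
Proof.
move=> cq uq.
have [cr ci] : cvgn (series (@complex.Re R \o u)) /\ cvgn (series (@complex.Im R \o u)).
  split; apply: normed_cvg; apply: (series_le_cvg _ _ _ cq) => //= k.
  - by rewrite -lecR (le_trans (normr_ge0 _) (uq k)).
  - by rewrite -lecR (le_trans (normc_ge_Re _)).
  - by rewrite -lecR (le_trans (normr_ge0 _) (uq k)).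
  - rewrite -lecR (le_trans _ (uq k)) // normc_def lecR -sqrtr_sqr ler_wsqrtr //.
    by rewrite lerDr sqr_ge0.
apply/cvg_ex; exists ((limn (series (@complex.Re R \o u)))%:C +
  'i%C * (limn (series (@complex.Im R \o u)))%:C).
rewrite (_ : series u = fun n => ((series (@complex.Re R \o u) n)%:C : R[i]^o) +
    ('i%C : R[i]^o) * (series (@complex.Im R \o u) n)%:C); last first.
  apply/funext => n; rewrite /series/= !rmorph_sum mulr_sumr -big_split /=.
  by apply: eq_bigr => k _; rewrite -complexE.
by apply: cvgD; [|apply: cvgM; first exact: cvg_cst]; apply: cvg_real_complex.
Qed.

Lemma limn_complex (R : realType) (f : nat -> R[i]^o) (l : R[i]^o) :
  f @ \oo --> l -> limn f = l.
Proof. by move=> fl; apply: cvg_lim fl; exact: norm_hausdorff. Qed.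

(** Generating function of a mass function on the naturals. The total mass may be below 1, as for a
    supremum that can be infinite. *)
Definition gf (R : realType) (q : nat -> R) (s : R[i]) : R[i] :=
  limn (series (fun k => s ^+ k * (q k)%:C) : nat -> R[i]^o).

Lemma norm_gf_term (R : realType) (q : nat -> R) (s : R[i]) k :
  (forall k, 0 <= q k) -> `|s| <= 1 -> `|s ^+ k * (q k)%:C| <= (q k)%:C.
Proof.
move=> q0 s1; rewrite normrM normrX [X in _ * X]ger0_norm ?lecR //.
by rewrite ler_piMl ?lecR // exprn_ile1.
Qed.

Lemma gf_cvg (R : realType) (q : nat -> R) (s : R[i]) :
  (forall k, 0 <= q k) -> cvgn (series q) -> `|s| <= 1 ->
  (series (fun k => s ^+ k * (q k)%:C) n : R[i]^o) @[n --> \oo] -->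
  (gf q s : R[i]^o).
Proof.
move=> q0 cq s1; apply: (cvg_series_complex cq) => k.
exact: norm_gf_term.
Qed.

(** The difference collects the products [u l * v k] with [l, k < n] and [l + k >= n]; the triangle
    inequality bounds it by the same sum for [a] and [b]. *)
Lemma norm_series_conv (R : rcfType) (a b : nat -> R) (u v : nat -> R[i]) n :
  (forall k, `|u k| <= (a k)%:C) -> (forall k, `|v k| <= (b k)%:C) ->
  `|series u n * series v n - series (conv u v) n| <=
  (series a n * series b n - series (conv a b) n)%:C.
Proof.
move=> ua vb; case: n => [|n].
  by rewrite /series /= !big_geq // !mul0r !subr0 normr0.
have E (S : comPzRingType) (f g : nat -> S) :
    series f n.+1 * series g n.+1 - series (conv f g) n.+1 =
    \sum_(0 <= l < n.+1) f l * \sum_(n.+1 - l <= k < n.+1) g k.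
  rewrite series_conv /conv {1}/series /= mulr_suml -sumrB.
  apply: eq_big_nat => l /andP[_ ln]; rewrite -mulrBr -subSn //; congr (_ * _).
  rewrite /series /= (big_cat_nat (leq0n _) (leq_subr l n.+1)) /=.
  by rewrite addrAC subrr add0r.
rewrite !E rmorph_sum; apply: le_trans (ler_norm_sum _ _ _) _.
apply: ler_sum => l _; rewrite normrM rmorphM rmorph_sum.
by apply: ler_pM => //; apply: le_trans (ler_norm_sum _ _ _) (ler_sum _ _).
Qed.

(** The gap between the product of partial sums and the partial sum of the Cauchy product is
    dominated by the gap at [s = 1], which vanishes in the limit by [cvg_series_conv]. This covers
    the circle [|s| = 1] too. *)
Lemma gf_conv (R : realType) (a b : nat -> R) (s : R[i]) :
  (forall k, 0 <= a k) -> (forall k, 0 <= b k) ->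
  cvgn (series a) -> cvgn (series b) -> `|s| <= 1 ->
  gf (conv a b) s = gf a s * gf b s.
Proof.
move=> a0 b0 ca cb s1.
have cc : series (conv a b) @ \oo --> limn (series a) * limn (series b).
  exact: cvg_series_conv.
have c0 k : 0 <= conv a b k by exact: conv_ge0.
pose u k := s ^+ k * (a k)%:C; pose v k := s ^+ k * (b k)%:C.
have uvE k : s ^+ k * (conv a b k)%:C = conv u v k.
  rewrite /conv rmorph_sum mulr_sumr; apply: eq_big_nat => l /andP[_ lk].
  by rewrite rmorphM /u /v mulrACA -exprD subnKC.
have D : (series u n * series v n - series (conv u v) n : R[i]^o)
    @[n --> \oo] --> (0 : R[i]^o).
  have /cvg_real_complex d0 : series a n * series b n - series (conv a b) n
      @[n --> \oo] --> (0 : R).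
    by rewrite -[X in _ --> X](subrr (limn (series a) * limn (series b)));
      apply: cvgB => //; apply: cvgM.
  apply/cvgrPdist_lt => e e0; move/cvgrPdist_lt: d0 => /(_ e e0).
  apply: filterS => n; rewrite !sub0r !normrN.
  have h : `|series u n * series v n - series (conv u v) n| <=
      (series a n * series b n - series (conv a b) n)%:C.
    by apply: norm_series_conv => k; apply: norm_gf_term.
  by rewrite (ger0_norm (le_trans (normr_ge0 _) h)); apply: le_lt_trans.
have cu := gf_cvg a0 ca s1; have cv := gf_cvg b0 cb s1.
have cw := @gf_cvg R _ s c0 (cvgP _ cc) s1.
apply/esym/subr0_eq.
rewrite (_ : (fun k => s ^+ k * (conv a b k)%:C) = conv u v) in cw; last exact/funext.
exact: (cvg_unique _ (cvgB (cvgM cu cv) cw) D).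
Qed.

(** * The effect of a shift followed by truncation at 0 *)

(** Summation by parts; it is the source of the factor [1 - s] in the first identity. *)
Lemma abel_series (R : comPzRingType) (c : nat -> R) (s : R) n :
  \sum_(0 <= k < n.+1) s ^+ k * c k =
  s ^+ n * series c n.+1 + (1 - s) * \sum_(0 <= u < n) s ^+ u * series c u.+1.
Proof.
elim: n => [|n IH].
  by rewrite /series /= !big_nat1 big_geq // mulr0 addr0.
rewrite big_nat_recr //= IH [in RHS]big_nat_recr //= [series c n.+2]seriesSr exprS.
ring.
Qed.

(** Passes to the limit in a relation between partial sums of two generating functions that are cut
    at indices differing by a constant. *)
Lemma lim_affine_shift (K : numFieldType) (f g : nat -> K) (x y : nat) (c z l l' : K) :
  f n @[n --> \oo] --> l -> g n @[n --> \oo] --> l' ->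
  (forall n, f (n + x)%N = c * g (n + y)%N - z) -> l = c * l' - z.
Proof.
move=> fl gl E.
have A : f (n + x)%N @[n --> \oo] --> l by rewrite (cvg_shiftn x f).
have B : c * g (n + y)%N - z @[n --> \oo] --> c * l' - z.
  apply: cvgB; last exact: cvg_cst.
  by apply: cvgM; [exact: cvg_cst|rewrite (cvg_shiftn y g)].
have EE : (fun n => f (n + x)%N) = (fun n => c * g (n + y)%N - z) by exact/funext.
by rewrite EE in A; apply: (cvg_unique _ A B).
Qed.

Lemma neg_part_Posz (m : nat) : neg_part m = 0%N.
Proof. by rewrite /neg_part max_l // oppr_le0. Qed.

(* To be read with [c] and [c'] the laws of some [Y >= 0] and of [max(0, m + Y)]. *)
Lemma gf_reflect (R : realType) (c c' : nat -> R) (m : int) (s : R[i]) :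
  (forall k, 0 <= c k) -> (forall k, 0 <= c' k) ->
  cvgn (series c) -> cvgn (series c') ->
  (forall k : nat, series c' k.+1 =
    if m <= k%:Z then series c `|k%:Z - m|%N.+1 else 0) ->
  `|s| <= 1 -> s != 0 ->
  gf c' s = s ^ m * gf c s -
    (1 - s) * s ^ m * \sum_(0 <= u < neg_part m) s ^+ u * (series c u.+1)%:C.
Proof.
move=> c0 c'0 cc cc' h s1 sn0.
pose U k := s ^+ k * (c k)%:C; pose U' k := s ^+ k * (c' k)%:C.
have c'S k : c' k.+1 = series c' k.+2 - series c' k.+1 by rewrite seriesSB.
have c'Z : c' 0 = series c' 1 by rewrite /series /= big_nat1.
have U'l := gf_cvg c'0 cc' s1; have Ul := gf_cvg c0 cc s1.
suff [x [y [z [E ->]]]] : exists x y z, (forall K, series U' (K + x)%N =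
    s ^ m * series U (K + y)%N - z) /\ (1 - s) * s ^ m *
    \sum_(0 <= u < neg_part m) s ^+ u * (series c u.+1)%:C = z.
  exact: (lim_affine_shift U'l Ul E).
case: m h => [m|m] h.
  exists m, 0%N, 0; split; last first.
    by rewrite neg_part_Posz big_geq ?mulr0.
  have sub k : (m <= k)%N -> `|k%:Z - m%:Z|%N = (k - m)%N.
    by move=> mk; rewrite subzn.
  have c'E k : c' k = if (m <= k)%N then c (k - m)%N else 0.
    case: k => [|k].
      rewrite c'Z h lez_nat leqn0 sub0n; case: eqP => [->|//].
      by rewrite /series /= big_nat1.
    rewrite c'S !h !lez_nat; case: ltngtP => [mk|mk|->].
    - by rewrite ltnS in mk; rewrite mk !sub ?leqW // subSn // seriesSB.
    - by rewrite leqNgt ltnW // subr0.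
    - by rewrite ltnn subr0 subrr absz0 subnn /series /= big_nat1.
  elim=> [|K IH].
    rewrite add0n subr0 /series /= [in RHS]big_geq // mulr0 big_nat big1 //.
    by move=> k /andP[_ km]; rewrite /U' c'E leqNgt km mulr0.
  rewrite addSn seriesSr IH !subr0 !addn0 [in RHS]seriesSr mulrDr; congr (_ + _).
  by rewrite /U' c'E leq_addl addnK exprD /U -exprnP mulrA [_ * s ^+ K]mulrC.
(* Index 0 of [c'] absorbs the mass of [c] at the indices [0, ..., m.+1], that is one term of [U']
   against [m.+2] terms of [U]. *)
exists 1%N, m.+2, ((1 - s) * s ^ (Negz m) *
    \sum_(0 <= u < neg_part (Negz m)) s ^+ u * (series c u.+1)%:C); split => //.
have np : neg_part (Negz m) = m.+1 by [].
have sE k : s ^ Negz m * s ^+ (k + m.+1) = s ^+ k.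
  by rewrite NegzE -exprnN exprD mulrCA mulVf ?mulr1 // expf_neq0.
have sub k : (k%:Z - Negz m = (k + m.+1)%N) by rewrite NegzE opprK.
have c'N k : c' k.+1 = c (k.+1 + m.+1)%N.
  rewrite c'S !h !sub /= [series c (_ + _).+1]seriesSr.
  by rewrite addSn [X in X - _]addrC addrK.
rewrite np; elim=> [|K IH].
  have cC n : series (fun k => (c k)%:C) n = (series c n)%:C.
    by rewrite /series /= rmorph_sum.
  (* Summation by parts over the absorbed indices: the boundary term is [c' 0] up to a power of [s],
     and the rest is the correction term. *)
  have A : series U m.+2 = s ^+ m.+1 * (series c m.+2)%:C +
      (1 - s) * \sum_(0 <= u < m.+1) s ^+ u * (series c u.+1)%:C.
    rewrite /series /= abel_series cC; congr (_ + _ * _).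
    by apply: eq_bigr => u _; rewrite cC.
  rewrite !add0n {1}/series /= big_nat1 /U' mul1r c'Z h sub /= add0n.
  have s0 := sE 0%N; rewrite add0n expr0 in s0.
  by rewrite A mulrDr mulrA s0 mul1r mulrCA mulrA addrK.
rewrite addSn seriesSr IH addSn seriesSr mulrDr addrAC; congr (_ + _ - _).
by rewrite /U' addn1 c'N -[(K + m.+2)%N]addSnnS /U mulrA sE.
Qed.

Lemma conv_cst1 (R : comPzRingType) (b : nat -> R) n :
  conv (fun=> 1) b n = series b n.+1.
Proof.
rewrite convC /conv /series /=.
by apply: eq_bigr => l _; rewrite mulr1.
Qed.

(** Both partial sums are convolutions with [u], of the constant 1 and of the cumulated [a]. If [a]
    has mass 1, the tail that remains sums to the mean of [a], which is how an expectation
    enters. *)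
Lemma series_sub_conv (R : comPzRingType) (a u : nat -> R) n :
  series u n.+1 - series (conv a u) n.+1 =
  conv (fun r => 1 - series a r.+1) u n.
Proof.
rewrite -conv_cst1 (_ : conv a u = conv u a); last first.
  by apply/funext => k; rewrite convC.
rewrite series_conv [conv u _ n]convC /conv -sumrB.
by apply: eq_bigr => l _; rewrite mulrBl.
Qed.

(* To be read with [u] and [v] the distribution functions of a possibly defective [M] and of
   [max(0, m + Y + M)], where [Y] is independent of [M] and has law [a]. The limit is then
   [P(M < oo) * E[m + Y] + E[max(0, - (m + Y + M))]], even if [M] has infinite mean. *)
Lemma cvg_drift (R : realType) (a u v : nat -> R) (m : int) (e p : R) :
  (forall k, 0 <= a k) -> (forall r, series a r <= 1) ->
  series (fun r => 1 - series a r.+1) @ \oo --> e ->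
  (forall k, 0 <= u k) -> {homo u : k l / (k <= l)%N >-> k <= l} ->
  u @ \oo --> p ->
  (forall k : nat, v k = if m <= k%:Z then conv a u `|k%:Z - m|%N else 0) ->
  \sum_(0 <= k < n) (u k - v k) @[n --> \oo] -->
    p * (m%:~R + e) + \sum_(0 <= k < neg_part m) conv a u k.
Proof.
move=> a0 a1 te u0 u_nd up vE.
have D : series u n - series (conv a u) n @[n --> \oo] --> p * e.
  rewrite -(cvg_shiftS (fun n => series u n - series (conv a u) n)) mulrC /=.
  under eq_cvg do rewrite series_sub_conv.
  by apply: cvg_conv => // k; rewrite subr_ge0.
(* A window of [d] consecutive terms of a convergent sequence tends to [d] times its limit; this
   yields the term [p * m]. *)
have S0 (w : nat -> R) (l : R) : w @ \oo --> l -> forall d,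
    series w (n + d)%N - series w n @[n --> \oo] --> l * d%:R.
  move=> wl; elim=> [|d IH].
    under eq_cvg do rewrite addn0 subrr.
    by rewrite mulr0; exact: cvg_cst.
  under eq_cvg do rewrite addnS seriesSr addrAC.
  rewrite -natr1 mulrDr mulr1; apply: cvgD => //.
  by rewrite (cvg_shiftn d w).
case: m vE => m vE.
- rewrite neg_part_Posz big_geq // addr0 mulrDr.
  have E k : \sum_(0 <= i < (k + m)%N) (u i - v i) =
      (series u (k + m)%N - series u k) + (series u k - series (conv a u) k).
    rewrite subrKA sumrB; congr (_ - _).
    rewrite (big_cat_nat (leq0n m) (leq_addl k m)) /= big_nat big1 ?add0r; last first.
      by move=> i /andP[_ im]; rewrite vE lez_nat leqNgt im.
    rewrite -{1}[m]add0n big_addn addnK; apply: eq_bigr => i _.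
    by rewrite vE lez_nat leq_addl PoszD addrK.
  have A : \sum_(0 <= i < (k + m)%N) (u i - v i) @[k --> \oo] --> p * m%:R + p * e.
    under eq_cvg do rewrite E.
    by apply: cvgD; [exact: S0|exact: D].
  by rewrite (cvg_shiftn m (fun n => \sum_(0 <= i < n) (u i - v i))) in A.
- have np : neg_part (Negz m) = m.+1 by [].
  (* [v] skips the values of [conv a u] below index [m.+1]; these are left over and form the last
     sum. *)
  have E k : \sum_(0 <= i < k) (u i - v i) =
      (series u (k + m.+1)%N - series (conv a u) (k + m.+1)%N) -
      (series u (k + m.+1)%N - series u k) + \sum_(0 <= i < m.+1) conv a u i.
    rewrite sumrB [series (conv a u) _]/series /=.
    rewrite (big_cat_nat (leq0n m.+1) (leq_addl k m.+1)) /=.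
    have -> : \sum_(m.+1 <= i < k + m.+1) conv a u i =
        \sum_(0 <= i < k) conv a u (i + m.+1)%N.
      by rewrite -{1}[m.+1]add0n big_addn addnK.
    have -> : \sum_(0 <= i < k) v i = \sum_(0 <= i < k) conv a u (i + m.+1)%N.
      by apply: eq_bigr => i _; rewrite vE NegzE opprK.
    by rewrite /series /=; ring.
  under eq_cvg do rewrite E.
  rewrite np; apply: cvgD; last exact: cvg_cst.
  rewrite mulrDr NegzE mulrNz mulrN addrC; apply: cvgB; last exact: S0.
  by rewrite (cvg_shiftn m.+1 (fun n => series u n - series (conv a u) n)).
Qed.

(** Adding an independent finite variable and truncating at 0 preserves the mass [p] of a possibly
    defective law. *)
Lemma cvg_shift_conv (R : realType) (a u v : nat -> R) (m : int) (p : R) :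
  (forall k, 0 <= a k) -> series a @ \oo --> (1 : R) ->
  (forall k, 0 <= u k) -> {homo u : k l / (k <= l)%N >-> k <= l} ->
  u @ \oo --> p ->
  (forall k : nat, v k = if m <= k%:Z then conv a u `|k%:Z - m|%N else 0) ->
  v @ \oo --> p.
Proof.
move=> a0 a1 u0 u_nd up vE; have cp := cvg_conv a0 u0 u_nd a1 up.
have sh : `|k%:Z - m|%N @[k --> \oo] --> \oo.
  apply/cvgnyPge => A; exists (A + `|m|)%N => //= k /= Ak; lia.
have A := cvg_comp _ _ sh cp; rewrite mul1r in A.
apply: cvg_trans A; apply: near_eq_cvg; exists `|m|%N => //= k /= mk.
by rewrite vE ifT //; lia.
Qed.

(** Terms with [r + i = u] are collected, which turns the double sum of the statement into a single
    sum of convolution values. *)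
Lemma sum_triangle (R : comPzRingType) (b f : nat -> R) (s : R) n :
  \sum_(0 <= i < n) b i * \sum_(0 <= r < n - i) s ^+ (r + i) * f r =
  \sum_(0 <= u < n) s ^+ u * conv b f u.
Proof.
elim: n => [|n IH]; first by rewrite !big_geq.
rewrite [RHS]big_nat_recr //= -IH big_nat_recr //= subSnn big_nat1 add0n.
rewrite /conv (big_nat_recr n) //= subnn mulrDr addrA mulrCA; congr (_ + _).
rewrite mulr_sumr -big_split /=; apply: eq_big_nat => i /andP[_ ni].
rewrite subSn ?(ltnW ni) // big_nat_recr //= mulrDr subnK ?(ltnW ni) //.
by rewrite [b i * (s ^+ n * _)]mulrCA.
Qed.

(** * Events of the walk and conditioning on one step *)

Section WalkLaw.
Context {d : measure_display} {T : measurableType d} {R : realType}.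
Variable P : probability T R.

Definition pr (A : set T) : R := fine (P A).

Lemma prE A : measurable A -> P A = (pr A)%:E.
Proof. by move=> mA; rewrite fineK // fin_num_measure. Qed.

Lemma pr_ge0 A : 0 <= pr A.
Proof. by rewrite fine_ge0. Qed.

Lemma pr_le1 A : measurable A -> pr A <= 1.
Proof. by move=> mA; rewrite -lee_fin -prE // probability_le1. Qed.

Lemma le_pr A B : measurable A -> measurable B -> A `<=` B -> pr A <= pr B.
Proof. by move=> mA mB AB; rewrite -lee_fin -!prE // le_measure ?inE. Qed.

Lemma pr_setD A B : measurable A -> measurable B -> B `<=` A ->
  pr (A `\` B) = pr A - pr B.
Proof.
move=> mA mB BA; have /(congr1 fine) := measureDI P mA mB.
rewrite (setIidr BA) fineD ?fin_num_measure //; last exact: measurableD.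
by rewrite -[fine (P A)]/(pr A) => ->; rewrite addrK.
Qed.

Lemma pr_bigU (F : nat -> set T) n :
  (forall l, measurable (F l)) -> trivIset setT F ->
  pr (\bigcup_(l < n) F l) = \sum_(0 <= l < n) pr (F l).
Proof.
move=> mF tF; rewrite /pr bigcup_mkord measure_bigsetU //.
by rewrite big_mkord -sum_fine // => i _; rewrite fin_num_measure.
Qed.

Variables (X : nat -> {RV P >-> R}) (lo : nat -> int).
Hypothesis X_int : forall k t, (1 <= k)%N -> X k t \is a Num.int.
Hypothesis X_indep : mutually_independent [set k : nat | (1 <= k)%N] X.
Hypothesis X_lo : forall k, (1 <= k)%N -> P [set t | (lo k)%:~R <= X k t] = 1%E.

(** The law of [X k - lo k], which moves every step to the naturals. *)
Definition atom (k l : nat) : R := pr [set t | X k t = (lo k + l%:Z)%:~R].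

Definition cylinder (J : {fset nat}) (B : nat -> set R) : set T :=
  \bigcap_(k in [set` J]) (X k @^-1` B k).

(** An almost sure event on which every [X k] is [lo k] plus a natural number; equalities of
    probabilities are checked on it only. *)
Definition good : set T :=
  \bigcap_(k in [set k | (1 <= k)%N]) [set t | (lo k)%:~R <= X k t].

Lemma measurable_point k c : measurable [set t | X k t = c].
Proof. exact: (measurable_funPTI (X k) (measurable_set1 c)). Qed.

Lemma measurable_ge k c : measurable [set t | c <= X k t].
Proof.
rewrite (_ : [set t | _] = X k @^-1` `[c, +oo[); first exact: measurable_funPTI.
by apply/seteqP; split => t /=; rewrite in_itv /= andbT.
Qed.

Lemma measurable_sum_le (r : seq nat) c :
  measurable [set t | \sum_(k <- r) X k t <= c].
Proof.
rewrite -[X in measurable X]setTI; apply: measurable_fun_le => //.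
by apply: measurable_sum => k; exact: measurable_funP.
Qed.

Lemma measurable_sum_eq (r : seq nat) c :
  measurable [set t | \sum_(k <- r) X k t = c].
Proof.
rewrite -[X in measurable X]setTI.
have mf : measurable_fun setT (fun t => \sum_(k <- r) X k t).
  by apply: measurable_sum => k; exact: measurable_funP.
exact: mf _ _ (measurable_set1 c).
Qed.

Lemma measurable_cylinder J B :
  (forall k, k \in J -> measurable (B k)) -> measurable (cylinder J B).
Proof.
move=> mB; apply: bigcap_measurableType => k kJ.
by apply: measurable_funPTI; exact: mB.
Qed.

Lemma measurable_good : measurable good.
Proof. by apply: bigcap_measurableType => k _; exact: measurable_ge. Qed.

Lemma pr_setIgood A : measurable A -> pr (A `&` good) = pr A.
Proof.
move=> mA; have mG := measurable_good.
have G0 : P (~` good) = 0%E.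
  rewrite setC_bigcap; apply: measure_negligible.
    by rewrite -setC_bigcap; exact: measurableC.
  rewrite bigcup_mkcond; apply: negligible_bigcup => k.
  case: ifPn => [|_]; last exact: negligible_set0.
  rewrite inE => k1; apply/negligibleP; first by apply: measurableC; exact: measurable_ge.
  have := probability_setC P (measurable_ge k (lo k)%:~R).
  by rewrite X_lo // subee.
have DG : P (A `\` good) = 0%E.
  apply: subset_measure0 G0; first exact: measurableD.
  - exact: measurableC.
  - by move=> t [].
have := measureDI P mA mG.
rewrite [X in (X + _)%E](_ : _ = 0%E); last exact: DG.
by rewrite add0e /pr => ->.
Qed.

Lemma pr_good_eq A B : measurable A -> measurable B ->
  (forall t, good t -> A t <-> B t) -> pr A = pr B.
Proof.
move=> mA mB AB; rewrite -(pr_setIgood mA) -(pr_setIgood mB); congr pr.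
by apply/seteqP; split => t [? ?]; split => //; apply/AB.
Qed.

Lemma int_atom k t n : (1 <= k)%N -> good t -> X k t <= (lo k + n%:Z)%:~R ->
  exists2 l, (l <= n)%N & X k t = (lo k + l%:Z)%:~R.
Proof.
move=> k1 /(_ k k1) /= lok; have /intrP[z zE] := X_int t k1.
rewrite zE !ler_int in lok * => zn.
have zlo : 0 <= z - lo k by rewrite subr_ge0.
exists `|z - lo k|%N; last by rewrite gez0_abs // subrKC.
by rewrite -lez_nat gez0_abs // lerBlDl.
Qed.

(** Total probability over the value of [X k]; the upper bound on [A] keeps the sum finite. *)
Lemma pr_split k n A : (1 <= k)%N -> measurable A ->
  (forall t, good t -> A t -> X k t <= (lo k + n%:Z)%:~R) ->
  pr A = \sum_(0 <= l < n.+1)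
    pr (A `&` [set t | X k t = (lo k + l%:Z)%:~R]).
Proof.
move=> k1 mA An.
have mF l : measurable (A `&` [set t | X k t = (lo k + l%:Z)%:~R]).
  by apply: measurableI => //; exact: measurable_point.
rewrite -pr_bigU //; last first.
  apply/trivIsetP => i j _ _ ij; apply/seteqP; split => // t [[_ /= ->]] [_ /= /intr_inj].
  by move=> /addrI[] /eqP; rewrite (negPf ij).
apply: pr_good_eq => //; first exact: bigcup_measurable.
move=> t gt; split => [At|[l _ []//]].
have [l ln Xl] := int_atom k1 gt (An _ gt At).
by exists l.
Qed.

Lemma pr_cylinderE J B :
  (forall k, k \in J -> (1 <= k)%N) -> (forall k, k \in J -> measurable (B k)) ->
  pr (cylinder J B) = \prod_(k <- J) pr (X k @^-1` B k).
Proof.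
move=> J1 mB; rewrite /pr X_indep //.
have : all (mem J) J by apply/allP.
elim: (enum_fset J) => [|k s IH] /=; first by rewrite !big_nil.
move=> /andP[kJ sJ]; rewrite !big_cons fineM ?IH //.
- by apply: fin_num_measure; apply: measurable_funPTI; exact: mB.
- elim: s sJ {IH} => [|i s IH] /=; rewrite ?big_nil // big_cons => /andP[iJ sJ].
  rewrite fin_numM ?IH //.
  by apply: fin_num_measure; apply: measurable_funPTI; exact: mB.
Qed.

Lemma cylinder_cons J B k (c : R) : k \notin J ->
  cylinder J B `&` [set t | X k t = c] =
  cylinder (k |` J)%fset (fun i => if i == k then [set c] else B i).
Proof.
move=> kJ; apply/seteqP; split => t.
- move=> [Jt kt] i /=; rewrite in_fset1U; case: eqP => [->//|_] /= iJ.
  exact: Jt.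
- move=> Jt; split => [i iJ|]; last first.
    by have := Jt k; rewrite /= fset1U1 eqxx; apply.
  have := Jt i; rewrite /= in_fset1U (_ : i \in J) // orbT => /(_ isT).
  by case: eqP => // ik; rewrite -ik iJ in kJ.
Qed.

Lemma pr_set0 : pr set0 = 0.
Proof. by rewrite /pr measure0. Qed.

Lemma cylinder_cons_prod J B k l : k \notin J ->
  \prod_(i <- (k |` J)%fset)
    pr (X i @^-1` (if i == k then [set (lo k + l%:Z)%:~R] else B i)) =
  atom k l * \prod_(i <- J) pr (X i @^-1` B i).
Proof.
move=> kJ; rewrite big_fsetU1 //= eqxx; congr (_ * _).
rewrite big_seq [RHS]big_seq; apply: eq_bigr => i iJ.
by case: eqP => // ik; rewrite -ik iJ in kJ.
Qed.

(** * Laws of finite-horizon maxima and of finite sums *)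

Definition walk_le (j n k : nat) : set T :=
  \bigcap_(i in [set i | (i <= n)%N])
    [set t | \sum_(j <= r < j + i) X r t <= k%:R].

Lemma measurable_walk_le j n k : measurable (walk_le j n k).
Proof. by apply: bigcap_measurableType => i _; exact: measurable_sum_le. Qed.

(** First-step recursion for the maximum over horizon [n]: [X j = lo j + l] leaves the bound
    [k - lo j - l] to the walk started at [j.+1], and [lo j > k] leaves no admissible value of
    [X j]. *)
Fixpoint walk_cdf (n j k : nat) : R :=
  if n is n'.+1 then
    if lo j <= k%:Z then conv (atom j) (walk_cdf n' j.+1) `|k%:Z - lo j|%N else 0
  else 1.

Lemma walk_le_step j n k l : lo j <= k%:Z -> (l <= `|k%:Z - lo j|)%N ->
  walk_le j n.+1 k `&` [set t | X j t = (lo j + l%:Z)%:~R] =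
  [set t | X j t = (lo j + l%:Z)%:~R] `&` walk_le j.+1 n (`|k%:Z - lo j| - l).
Proof.
move=> lok lq.
have step t i : X j t = (lo j + l%:Z)%:~R ->
    (\sum_(j <= r < j + i.+1) X r t <= k%:R) =
    (\sum_(j.+1 <= r < j.+1 + i) X r t <= (`|k%:Z - lo j| - l)%:R).
  move=> Xl; rewrite big_ltn ?ltnS ?addnS ?leq_addr // Xl addSn -lerBrDl.
  congr (_ <= _); rewrite -[k%:R]/(k%:Z%:~R) -[RHS]/((_ - _)%N%:Z%:~R) -intrB.
  by rewrite -subzn // gez0_abs ?subr_ge0 // opprD addrA.
apply/seteqP; split=> t [].
  by move=> wt Xl; split=> // i /= ni; rewrite -step //; exact: wt.
move=> Xl wt; split=> // -[|i] /= ni; first by rewrite addn0 big_geq.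
by rewrite step //; exact: wt.
Qed.

(* The cylinder over earlier indices strengthens the induction on [n]: each step moves [X j]
   into it, so that only the product rule on cylinders is ever needed. *)
Lemma pr_walk_le n j k J B : (1 <= j)%N ->
  (forall i, i \in J -> (1 <= i < j)%N) ->
  (forall i, i \in J -> measurable (B i)) ->
  pr (cylinder J B `&` walk_le j n k) =
  (\prod_(i <- J) pr (X i @^-1` B i)) * walk_cdf n j k.
Proof.
elim: n j k J B => [|n IH] j k J B j1 Jj mB.
  rewrite mulr1 -pr_cylinderE //; last by move=> i /Jj /andP[].
  congr pr; apply/setIidPl => t _ i /=; rewrite leqn0 => /eqP ->.
  by rewrite addn0 big_geq.
have mE : measurable (cylinder J B `&` walk_le j n.+1 k).
  by apply: measurableI; [exact: measurable_cylinder|exact: measurable_walk_le].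
(* The partial sum of length 1 caps [X j] at [k], as [pr_split] requires. *)
have Xk t : walk_le j n.+1 k t -> X j t <= k%:Z%:~R.
  by move=> /(_ 1%N isT); rewrite /= addn1 big_nat1.
rewrite /=; case: ifPn => [lok|/negP lok]; last first.
  rewrite mulr0 -[RHS]pr_set0; apply: pr_good_eq => // t gt; split=> // -[_ /Xk].
  by move=> /(le_trans (gt j j1)); rewrite ler_int.
have kE : k%:Z = lo j + `|k%:Z - lo j|%:Z by rewrite gez0_abs ?subr_ge0 // subrKC.
rewrite (@pr_split j `|k%:Z - lo j|%N) //; last first.
  by move=> t gt [_ /Xk]; rewrite {1}kE.
rewrite /conv mulr_sumr; apply: eq_big_nat => l /andP[_]; rewrite ltnS => lq.
have jJ : j \notin J by apply/negP => /Jj; rewrite ltnn andbF.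
rewrite -setIA walk_le_step // setIA cylinder_cons // IH //.
- by rewrite cylinder_cons_prod // mulrCA mulrA.
- by move=> i; rewrite in_fset1U => /predU1P[->|/Jj/andP[-> /ltnW]]; rewrite ?j1 /= ltnS.
- move=> i; rewrite in_fset1U; case: eqP => [_ _|_ /= iJ]; last exact: mB.
  exact: measurable_set1.
Qed.

Definition sum_at (r : seq nat) (n : nat) : set T :=
  [set t | \sum_(k <- r) X k t = (\sum_(k <- r) lo k + n%:Z)%:~R].

Definition sum_pmf (r : seq nat) : nat -> R :=
  foldr (fun k => conv (atom k)) (fun n => (n == 0)%:R) r.

(** As in [pr_walk_le], the cylinder holds the indices already conditioned on. The list [r] may come
    in any order, so that it can be [N] followed by [1, ..., j - 1]. *)
Lemma pr_sum_at r n J B : uniq r -> all (leq 1) r ->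
  (forall i, i \in J -> (1 <= i)%N && (i \notin r)) ->
  (forall i, i \in J -> measurable (B i)) ->
  pr (cylinder J B `&` sum_at r n) =
  (\prod_(i <- J) pr (X i @^-1` B i)) * sum_pmf r n.
Proof.
elim: r n J B => [|k r IH] n J B.
  move=> _ _ J1 mB; rewrite -pr_cylinderE //; last by move=> i /J1/andP[].
  rewrite /sum_at /sum_pmf !big_nil add0r /=; case: (n =P 0%N) => [->|n0].
    by rewrite mulr1; congr pr; apply/setIidPl => t _ /=; rewrite big_nil.
  rewrite mulr0 -[RHS]pr_set0; congr pr.
  have nR : (n%:Z%:~R : R) <> 0 by move/eqP; rewrite intr_eq0 eqz_nat => /eqP.
  by apply/seteqP; split=> // t [_ /=]; rewrite big_nil => /esym.
move=> /andP[kr ur] /andP[k1 r1] J1 mB.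
have mE : measurable (cylinder J B `&` sum_at (k :: r) n).
  by apply: measurableI; [exact: measurable_cylinder|exact: measurable_sum_eq].
rewrite (@pr_split k n) //; last first.
  move=> t gt [_]; rewrite /sum_at /= !big_cons => E.
  (* The remaining summands are at least their lower bounds, which caps [X k] at [lo k + n]. *)
  have : (\sum_(i <- r) lo i)%:~R <= \sum_(i <- r) X i t.
    rewrite rmorph_sum big_seq [leRHS]big_seq; apply: ler_sum => i ir.
    by apply: gt => /=; move/allP: r1; apply.
  move: E; rewrite !intrD; lra.
rewrite /= /conv mulr_sumr; apply: eq_big_nat => l /andP[_]; rewrite ltnS => ln.
have kJ : k \notin J by apply/negP => /J1; rewrite inE eqxx andbF.
have -> : cylinder J B `&` sum_at (k :: r) n `&` [set t | X k t = (lo k + l%:Z)%:~R]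
    = cylinder J B `&` [set t | X k t = (lo k + l%:Z)%:~R] `&` sum_at r (n - l).
  have E t : X k t = (lo k + l%:Z)%:~R -> sum_at (k :: r) n t <-> sum_at r (n - l) t.
    move=> Xl; rewrite /sum_at /= !big_cons Xl -subzn // !(intrD, intrB).
    by split; lra.
  apply/seteqP; split=> t [] [] Jt A B'.
    by split=> //; apply/E.
  by split=> //; split=> //; apply/E.
rewrite cylinder_cons // IH //.
- by rewrite cylinder_cons_prod // mulrCA mulrA.
- move=> i; rewrite in_fset1U => /predU1P[->|/J1]; first by rewrite k1.
  by rewrite inE negb_or => /and3P[-> _ ->].
- move=> i; rewrite in_fset1U; case: eqP => [_ _|_ /= iJ]; last exact: mB.
  exact: measurable_set1.
Qed.

Lemma cylinder0 B : cylinder fset0 B = setT.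
Proof. by apply/seteqP; split=> t // _ k /=. Qed.

Lemma pr_walk_cdf n j k : (1 <= j)%N -> pr (walk_le j n k) = walk_cdf n j k.
Proof.
move=> j1; have := @pr_walk_le n j k fset0 (fun=> set0) j1.
by rewrite cylinder0 setTI big_seq_fset0 mul1r; apply.
Qed.

Lemma sum_pmfE r n : uniq r -> all (leq 1) r -> pr (sum_at r n) = sum_pmf r n.
Proof.
move=> ur r1; have := @pr_sum_at r n fset0 (fun=> set0) ur r1.
by rewrite cylinder0 setTI big_seq_fset0 mul1r; apply.
Qed.

(** * Suprema over the infinite horizon *)

Lemma walk_sup_le j k t :
  (walk_sup X j t <= k%:R%:E)%E <-> (\bigcap_n walk_le j n k) t.
Proof.
split=> [le n _ i _ /=|w].
  by rewrite -lee_fin; apply: le_trans le; apply: ereal_sup_ubound; exists i.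
by apply: ge_ereal_sup => _ [i _ <-]; rewrite lee_fin; exact: (w i I i (leqnn i)).
Qed.

Lemma walk_sup_ge0 j t : (0 <= walk_sup X j t)%E.
Proof. by apply: ereal_sup_ubound; exists 0%N => //; rewrite addn0 big_geq. Qed.

(** Its limit in [k] is the probability of a finite supremum, possibly below 1 at this stage. *)
Definition sup_cdf (j k : nat) : R := pr [set t | (walk_sup X j t <= k%:R%:E)%E].

Lemma sup_leE j k :
  [set t | (walk_sup X j t <= k%:R%:E)%E] = \bigcap_n walk_le j n k.
Proof. by apply/seteqP; split=> t /walk_sup_le. Qed.

Lemma measurable_sup_le j k : measurable [set t | (walk_sup X j t <= k%:R%:E)%E].
Proof. by rewrite sup_leE; apply: bigcapT_measurable => n; exact: measurable_walk_le. Qed.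

Lemma sup_cdf_ge0 j k : 0 <= sup_cdf j k. Proof. exact: pr_ge0. Qed.

Lemma sup_cdf_le1 j k : sup_cdf j k <= 1.
Proof. exact/pr_le1/measurable_sup_le. Qed.

Lemma sup_cdf_nd j : {homo sup_cdf j : k l / (k <= l)%N >-> k <= l}.
Proof.
move=> k l kl; apply: le_pr; try exact: measurable_sup_le.
by move=> t /= /le_trans; apply; rewrite lee_fin ler_nat.
Qed.

Lemma walk_cdf_nd n j : (1 <= j)%N ->
  {homo walk_cdf n j : k l / (k <= l)%N >-> k <= l}.
Proof.
move=> j1 k l kl; rewrite -!pr_walk_cdf //.
apply: le_pr; try exact: measurable_walk_le.
by move=> t wt i ni; apply: le_trans (wt i ni) _; rewrite ler_nat.
Qed.

Lemma walk_cdf_ge0 n j k : (1 <= j)%N -> 0 <= walk_cdf n j k.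
Proof. by move=> j1; rewrite -pr_walk_cdf // pr_ge0. Qed.

Lemma walk_cdf_nincr n j k : (1 <= j)%N -> walk_cdf n.+1 j k <= walk_cdf n j k.
Proof.
move=> j1; rewrite -!pr_walk_cdf //.
apply: le_pr; try exact: measurable_walk_le.
by move=> t wt i /leqW; exact: wt.
Qed.

(** Continuity of [P] from above, as the events [walk_le j n k] decrease in [n]. *)
Lemma cvg_walk_cdf j k : (1 <= j)%N -> walk_cdf n j k @[n --> \oo] --> sup_cdf j k.
Proof.
move=> j1; rewrite /sup_cdf sup_leE.
under eq_cvg do rewrite -pr_walk_cdf //.
apply: fine_cvg; rewrite -prE; last first.
  by apply: bigcapT_measurable => n; exact: measurable_walk_le.
apply: (@nonincreasing_cvg_mu _ _ _ P).
- by rewrite -ge0_fin_numE // fin_num_measure //; exact: measurable_walk_le.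
- by move=> n; exact: measurable_walk_le.
- by apply: bigcapT_measurable => n; exact: measurable_walk_le.
- move=> m n mn; apply/subsetPset => t wt i im; apply: wt.
  exact: leq_trans im mn.
Qed.

(** The limit in [n] of the recursion defining [walk_cdf], taken termwise in a finite sum; this
    encodes the independence of [X j] and the next supremum. *)
Lemma sup_cdfE j k : (1 <= j)%N ->
  sup_cdf j k =
  if lo j <= k%:Z then conv (atom j) (sup_cdf j.+1) `|k%:Z - lo j|%N else 0.
Proof.
move=> j1; have A := @cvg_walk_cdf j k j1.
rewrite -(cvg_shiftS (fun n => walk_cdf n j k)) /= in A.
apply: cvg_unique A _ => //; case: ifP => _; last exact: cvg_cst.
apply: cvg_sum_nat => l _; apply: cvgM; first exact: cvg_cst.
exact: cvg_walk_cdf.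
Qed.

Lemma walk_sup_pmf0 j : walk_sup_pmf X j 0 = sup_cdf j 0.
Proof.
rewrite /walk_sup_pmf -/(pr _); congr pr.
apply/seteqP; split=> t /=; first by move=> ->.
by move=> le; apply/eqP; rewrite eq_le le walk_sup_ge0.
Qed.

(** Partial sums are integers, so a supremum below [k.+1] is at most [k]. *)
Lemma walk_sup_pmfS j k : (1 <= j)%N ->
  walk_sup_pmf X j k.+1 = sup_cdf j k.+1 - sup_cdf j k.
Proof.
move=> j1; rewrite -pr_setD; try exact: measurable_sup_le; last first.
  by move=> t /= /le_trans; apply; rewrite lee_fin ler_nat.
rewrite /walk_sup_pmf -/(pr _); congr pr; apply/seteqP; split=> t /=.
  by move=> ->; split=> //; rewrite lee_fin ler_nat ltnn.
move=> [le nle]; apply/eqP; rewrite eq_le le /=.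
rewrite leNgt; apply/negP => lt; apply: nle.
apply: ge_ereal_sup => _ [i _ <-]; rewrite lee_fin.
have : ((\sum_(j <= r < j + i) X r t)%:E < k.+1%:R%:E)%E.
  by apply: le_lt_trans lt; apply: ereal_sup_ubound; exists i.
have /intrP[z ->] : \sum_(j <= r < j + i) X r t \is a Num.int.
  rewrite big_nat; apply: rpred_sum => r /andP[jr _].
  by apply: X_int; exact: leq_trans jr.
rewrite lte_fin -[k.+1%:R]/(k.+1%:Z%:~R) -[k%:R]/(k%:Z%:~R) ltr_int ler_int.
by rewrite -addn1 PoszD ltzD1.
Qed.

Lemma series_walk_sup_pmf j k : (1 <= j)%N ->
  series (walk_sup_pmf X j) k.+1 = sup_cdf j k.
Proof.
move=> j1; elim: k => [|k IH].
  by rewrite /series /= big_nat1 walk_sup_pmf0.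
by rewrite seriesSr IH walk_sup_pmfS // subrKC.
Qed.

(** * Tails of the steps and the expectation over one period *)

Lemma atom_ge0 k l : 0 <= atom k l. Proof. exact: pr_ge0. Qed.

Lemma measurable_le k c : measurable [set t | X k t <= c].
Proof.
rewrite (_ : [set t | _] = X k @^-1` `]-oo, c]); first exact: measurable_funPTI.
by apply/seteqP; split => t /=; rewrite in_itv.
Qed.

Lemma series_atom k n : (1 <= k)%N ->
  series (atom k) n.+1 = pr [set t | X k t <= (lo k + n%:Z)%:~R].
Proof.
move=> k1; rewrite (@pr_split k n) //; last exact: measurable_le.
apply: eq_big_nat => l /andP[_]; rewrite ltnS => ln; congr pr.
apply/esym/setIidPr => t /= ->; rewrite ler_int; lia.
Qed.

Lemma series_atom_cdf k n : (1 <= k)%N ->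
  series (atom k) n.+1 = cdf_at (X k) (lo k + n%:Z).
Proof.
by move=> k1; rewrite series_atom.
Qed.

Lemma series_atom_le1 k n : (1 <= k)%N -> series (atom k) n <= 1.
Proof.
move=> k1; case: n => [|n]; first by rewrite /series /= big_geq.
by rewrite series_atom // pr_le1 //; exact: measurable_le.
Qed.

Definition tail (k i : nat) : R := 1 - series (atom k) i.+1.

Lemma tail_ge0 k i : (1 <= k)%N -> 0 <= tail k i.
Proof. by move=> k1; rewrite subr_ge0 series_atom_le1. Qed.

Lemma measurable_gt k c : measurable [set t | c < X k t].
Proof.
rewrite (_ : [set t | _] = ~` [set t | X k t <= c]).
  by apply: measurableC; exact: measurable_le.
by apply/seteqP; split => t /=; rewrite ltNge => /negP.
Qed.

Lemma tailE k i : (1 <= k)%N ->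
  (tail k i)%:E = P [set t | (lo k + i%:Z)%:~R < X k t].
Proof.
move=> k1; have mA := measurable_le k (lo k + i%:Z)%:~R.
rewrite EFinB series_atom // -prE // -probability_setC //; congr (P _).
by apply/seteqP; split => t /=; rewrite ltNge => /negP.
Qed.

Lemma good_ae : \forall t \ae P, good t.
Proof.
exists (~` good); split => //; first exact: measurableC measurable_good.
by have := prE (measurableC measurable_good);
  rewrite -(pr_setIgood (measurableC measurable_good)) setICl pr_set0.
Qed.

(** On [good] this is [X k - lo k], written as a sum of indicators so that its integral is the sum
    of the tails. *)
Definition excess (k : nat) (t : T) : \bar R :=
  (\sum_(0 <= i <oo) (\1_[set t | (lo k + i%:Z)%:~R < X k t] t)%:E)%E.

Lemma excess_ge0 k t : (0 <= excess k t)%E.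
Proof. by apply: nneseries_ge0 => i _ _; rewrite lee_fin. Qed.

Lemma measurable_excess k : measurable_fun setT (excess k : T -> \bar R).
Proof.
apply: ge0_emeasurable_sum => [i t _ _|i _]; first by rewrite lee_fin.
by apply/measurable_EFinP; apply: measurable_indic; exact: measurable_gt.
Qed.

Lemma excessE k t : (1 <= k)%N -> good t ->
  (X k t)%:E = ((lo k)%:~R%:E + excess k t)%E.
Proof.
move=> k1 gt.
have [n Xn] : exists n : nat, X k t = (lo k + n%:Z)%:~R.
  have /intrP[z zE] := X_int t k1; have := gt k k1; rewrite /= zE ler_int => zl.
  exists `|z - lo k|%N; congr (_%:~R).
  by rewrite gez0_abs ?subr_ge0 // subrKC.
rewrite /excess (nneseries_split 0 n); last by move=> i _; rewrite lee_fin.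
rewrite eseries0 ?adde0; last first.
  move=> i ni _; rewrite indicE memNset //= Xn ltr_int.
  by rewrite ltrD2l ltz_nat ltnNge; apply/negP; rewrite negbK.
rewrite add0n Xn intrD EFinD; congr (_ + _)%E.
rewrite (eq_big_nat _ _ (F2 := fun=> 1%:E)); last first.
  by move=> i /andP[_ ni]; rewrite indicE mem_set //= Xn ltr_int ltrD2l ltz_nat.
by rewrite sumEFin sumr_const_nat subn0.
Qed.

Lemma integral_excess k : (1 <= k)%N ->
  (\int[P]_t excess k t = \sum_(0 <= i <oo) (tail k i)%:E)%E.
Proof.
move=> k1; rewrite integral_nneseries //.
- apply: eq_eseriesr => i _.
  by rewrite integral_indic // ?setIT ?tailE //; exact: measurable_gt.
- by move=> i; apply/measurable_EFinP; apply: measurable_indic; exact: measurable_gt.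
Qed.

(** The negative part is almost surely at most [|c|], and a positive part of infinite integral would
    make the expectation infinite instead of negative. Hence [f] is integrable, and the constant can
    be split off. *)
Lemma expectation_period_sum N :
  ('E_P[period_sum X N] < 0)%E ->
  ('E_P[period_sum X N] = (\sum_(1 <= k < N.+1) lo k)%:~R%:E +
    \sum_(1 <= k < N.+1) \sum_(0 <= i <oo) (tail k i)%:E)%E.
Proof.
rewrite expectation.unlock.
set f := period_sum X N; set c : R := _%:~R.
pose g t := (\sum_(1 <= k < N.+1) excess k t)%E.
have mf : measurable_fun setT f.
  by apply: measurable_sum => k; exact: measurable_funP.
have mEf : measurable_fun setT (EFin \o f) by exact/measurable_EFinP.
have g0 t : (0 <= g t)%E by apply: sume_ge0 => k _; exact: excess_ge0.
have mg : measurable_fun setT g.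
  by apply: emeasurable_sum => k; exact: measurable_excess.
have fg t : good t -> (f t)%:E = (c%:E + g t)%E.
  move=> gt; rewrite /f /period_sum /c /g -sumEFin rmorph_sum -sumEFin -big_split /=.
  by apply: eq_big_nat => k /andP[k1 _]; exact: excessE.
have gE : (\int[P]_t g t = \sum_(1 <= k < N.+1) \sum_(0 <= i <oo) (tail k i)%:E)%E.
  rewrite ge0_integral_sum //; last 2 first.
    by move=> k; exact: measurable_excess.
    by move=> k t _; exact: excess_ge0.
  by apply: eq_big_nat => k /andP[k1 _]; exact: integral_excess.
have neg : (\int[P]_t ((EFin \o f)^\- t) <= `|c|%:E)%E.
  rewrite -[leRHS]mule1 -(@probability_setT _ _ _ P) -integral_cst //.
  apply: ae_ge0_le_integral => //.
  - exact: measurable_funeneg.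
  - by move=> t _; rewrite lee_fin.
  apply: filterS good_ae => t gt _; rewrite funenegE ge_max -EFinN !lee_fin.
  rewrite normr_ge0 andbT -normrN; apply: le_trans (ler_norm _).
  by rewrite lerN2 -lee_fin fg // leeDl.
move=> ES.
have int : P.-integrable setT (EFin \o f).
  apply/integrableP; split => //.
  rewrite (eq_integral ((EFin \o f)^\+ \+ (EFin \o f)^\-)%E); last first.
    by move=> t _; exact: (congr1 (fun h => h t) (fune_abse (EFin \o f))).
  rewrite ge0_integralD //; last 2 first.
    exact: measurable_funepos.
    exact: measurable_funeneg.
  apply: lte_add_pinfty; last by apply: le_lt_trans neg _; rewrite ltry.
  rewrite ltey; apply/eqP => E; move: ES; rewrite integralE E.
  rewrite addye // eqe_oppLR /= -ltey; exact: le_lt_trans neg (ltry _).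
rewrite -gE.
have -> : (\int[P]_t g t = \int[P]_t ((f t)%:E - c%:E))%E.
  apply: ae_eq_integral => //.
    by apply: emeasurable_funB => //; exact: measurable_cst.
  by apply: filterS good_ae => t gt _; rewrite fg // addeAC subee // add0e.
rewrite integralB_EFin //; last exact: finite_measure_integrable_cst.
have -> : (\int[P]_t c%:E = c%:E)%E.
  by rewrite -[RHS]mule1 -(@probability_setT _ _ _ P) -integral_cst.
by rewrite [RHS]addeC subeK.
Qed.

Lemma cvg_series_atom k : (1 <= k)%N -> cvgn (series (atom k)).
Proof.
move=> k1; apply: nondecreasing_is_cvgn.
  by apply: nondecreasing_series => i _ _; exact: atom_ge0.
by exists 1 => _ [n _ <-]; exact: series_atom_le1.
Qed.

Lemma walk_sup_pmf_ge0 j k : 0 <= walk_sup_pmf X j k.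
Proof. exact: pr_ge0. Qed.

Lemma cvg_series_walk_sup_pmf j : (1 <= j)%N -> cvgn (series (walk_sup_pmf X j)).
Proof.
move=> j1; apply: nondecreasing_is_cvgn.
  by apply: nondecreasing_series => i _ _; exact: walk_sup_pmf_ge0.
exists 1 => _ [[|n] _ <-]; first by rewrite /series /= big_geq.
by rewrite series_walk_sup_pmf // sup_cdf_le1.
Qed.

Lemma sum_pmf_ge0 r n : 0 <= sum_pmf r n.
Proof.
elim: r n => [|k r IH] n /=; first exact: ler0n.
by apply: conv_ge0 => // l; exact: atom_ge0.
Qed.

Lemma cvg_series_sum_pmf r : all (leq 1) r -> cvgn (series (sum_pmf r)).
Proof.
elim: r => [_|k r IH /andP[k1 r1]].
  apply/cvg_ex; exists (1 : R); apply: cvg_near_cst; exists 1%N => // -[//|n] _ /=.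
  by rewrite /series /= big_nat_recl //= big1 ?addr0.
apply/cvg_ex; exists (limn (series (atom k)) * limn (series (sum_pmf r))).
apply: cvg_series_conv; first exact: atom_ge0.
- exact: sum_pmf_ge0.
- exact: cvg_series_atom.
- exact: IH.
Qed.

(** * Generating functions of steps, finite sums and suprema *)

Definition atom_gf (k : nat) (s : R[i]) : R[i] := s ^ lo k * gf (atom k) s.

Lemma pgf_gf (l : int) (Y : T -> \bar R) (q : nat -> R) (s : R[i]) :
  (forall k : nat, fine (P [set t | Y t = (l + k%:Z)%:~R%:E]) = q k) ->
  (forall k, 0 <= q k) -> cvgn (series q) -> `|s| <= 1 -> s != 0 ->
  pgf P l Y s = s ^ l * gf q s.
Proof.
move=> Yq q0 cq s1 s0; rewrite /pgf; apply: limn_complex.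
have A : (s ^ l * series (fun k => s ^+ k * (q k)%:C) n : R[i]^o)
    @[n --> \oo] --> (s ^ l * gf q s : R[i]^o).
  by apply: cvgM; [exact: cvg_cst|exact: gf_cvg].
apply: cvg_trans A; apply: near_eq_cvg; apply: nearW => n.
rewrite /series /= mulr_sumr; apply: eq_bigr => k _.
by rewrite Yq expfzDr // -exprnP mulrA.
Qed.

Lemma pgf_sum r (s : R[i]) : uniq r -> all (leq 1) r -> `|s| <= 1 -> s != 0 ->
  pgf P (\sum_(k <- r) lo k) (fun t => (\sum_(k <- r) X k t)%:E) s =
  \prod_(k <- r) atom_gf k s.
Proof.
move=> ur r1 s1 s0; rewrite (@pgf_gf _ _ (sum_pmf r)) //.
- elim: r ur r1 => [|k r IH] /= => [_ _|/andP[_ ur] /andP[k1 r1]].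
    rewrite !big_nil expr0z mul1r; apply: limn_complex.
    apply: cvg_near_cst; exists 1%N => // -[//|n] _ /=.
    rewrite /series /= big_nat_recl //= mul1r big1 ?addr0 // => i _.
    by rewrite mulr0.
  rewrite !big_cons expfzDr // -IH // gf_conv //.
  + by rewrite /atom_gf mulrACA.
  + exact: atom_ge0.
  + exact: sum_pmf_ge0.
  + exact: cvg_series_atom.
  + exact: cvg_series_sum_pmf.
- move=> k; rewrite -sum_pmfE // /pr /sum_at; congr (fine (P _)).
  by apply/seteqP; split=> t /= => [[]|->].
- exact: sum_pmf_ge0.
- exact: cvg_series_sum_pmf.
Qed.

Lemma pgf_walk_sup j (s : R[i]) : (1 <= j)%N -> `|s| <= 1 -> s != 0 ->
  pgf P 0 (walk_sup X j) s = gf (walk_sup_pmf X j) s.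
Proof.
move=> j1 s1 s0; rewrite (@pgf_gf _ _ (walk_sup_pmf X j)) //.
- by rewrite mul1r.
- exact: walk_sup_pmf_ge0.
- exact: cvg_series_walk_sup_pmf.
Qed.

(** Both sides are the distribution function of [X_j - m_j + M_(j+1)] at [u]; the cumulation is
    moved from one factor to the other. *)
Lemma conv_sup_cdf j u : (1 <= j)%N ->
  conv (atom j) (sup_cdf j.+1) u =
  conv (walk_sup_pmf X j.+1) (fun r => cdf_at (X j) (lo j + r%:Z)) u.
Proof.
move=> j1; rewrite (_ : (fun r => _) = fun r => series (atom j) r.+1); last first.
  by apply/funext => r; rewrite series_atom_cdf.
rewrite -series_conv (_ : conv (walk_sup_pmf X j.+1) _ =
    conv (atom j) (walk_sup_pmf X j.+1)); last by apply/funext => k; rewrite convC.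
rewrite series_conv; apply: eq_bigr => i _; congr (_ * _).
by rewrite series_walk_sup_pmf.
Qed.

Lemma overshoot_complex j (s : R[i]) n : (1 <= j)%N ->
  \sum_(0 <= i < n) (walk_sup_pmf X j.+1 i)%:C *
    \sum_(0 <= r < n - i) s ^+ (r + i) * (cdf_at (X j) (lo j + r%:Z))%:C =
  \sum_(0 <= u < n) s ^+ u * (conv (atom j) (sup_cdf j.+1) u)%:C.
Proof.
move=> j1; have := sum_triangle (fun i => (walk_sup_pmf X j.+1 i)%:C)
  (fun r => (cdf_at (X j) (lo j + r%:Z))%:C) s n => ->.
apply: eq_bigr => u _; congr (_ * _); rewrite conv_sup_cdf // /conv rmorph_sum.
by apply: eq_bigr => i _; rewrite rmorphM.
Qed.

Lemma overshoot_real j n : (1 <= j)%N ->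
  \sum_(0 <= i < n) walk_sup_pmf X j.+1 i *
    \sum_(0 <= r < n - i) cdf_at (X j) (lo j + r%:Z) =
  \sum_(0 <= u < n) conv (atom j) (sup_cdf j.+1) u.
Proof.
move=> j1; have := sum_triangle (walk_sup_pmf X j.+1)
  (fun r => cdf_at (X j) (lo j + r%:Z)) 1 n.
under eq_bigr do under eq_bigr do rewrite expr1n mul1r.
move=> ->; apply: eq_bigr => u _.
by rewrite expr1n mul1r conv_sup_cdf.
Qed.

(** [gf_reflect] for [Y = X_j - m_j + M_(j+1)], whose law is the convolution, with [max(0, m_j + Y)]
    distributed as [M_j]. *)
Lemma gf_walk_sup_step j (s : R[i]) : (1 <= j)%N -> `|s| <= 1 -> s != 0 ->
  gf (walk_sup_pmf X j) s = atom_gf j s * gf (walk_sup_pmf X j.+1) s -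
    (1 - s) * s ^ lo j * \sum_(0 <= u < neg_part (lo j))
      s ^+ u * (conv (atom j) (sup_cdf j.+1) u)%:C.
Proof.
move=> j1 s1 s0; have a0 := atom_ge0 j; have p0 := walk_sup_pmf_ge0 j.+1.
have ca := cvg_series_atom j1; have cp := @cvg_series_walk_sup_pmf j.+1 isT.
have convE n : series (conv (atom j) (walk_sup_pmf X j.+1)) n.+1 =
    conv (atom j) (sup_cdf j.+1) n.
  rewrite series_conv; apply: eq_bigr => i _.
  by rewrite series_walk_sup_pmf.
rewrite (@gf_reflect _ (conv (atom j) (walk_sup_pmf X j.+1)) _ (lo j)) //.
- rewrite gf_conv // /atom_gf mulrA; congr (_ - _ * _).
  by apply: eq_bigr => u _; rewrite convE.
- by move=> k; exact: conv_ge0.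
- exact: walk_sup_pmf_ge0.
- exact: cvgP (cvg_series_conv a0 p0 ca cp).
- exact: cvg_series_walk_sup_pmf.
- by move=> k; rewrite series_walk_sup_pmf // sup_cdfE // convE.
Qed.

(** * Summation over one period *)

Section Periodic.
Variable N : nat.
Hypothesis N_gt0 : (0 < N)%N.
Hypothesis lo_period : forall k, (1 <= k)%N -> lo (k + N) = lo k.
Hypothesis atom_period : forall k, (1 <= k)%N -> atom (k + N) = atom k.

Lemma walk_cdf_period n j k : (1 <= j)%N -> walk_cdf n (j + N) k = walk_cdf n j k.
Proof.
elim: n j k => [//|n IH] j k j1 /=; rewrite lo_period // atom_period //.
case: ifP => // _; apply: eq_bigr => l _.
by rewrite -addSn IH.
Qed.

Lemma sup_cdf_period j : (1 <= j)%N -> sup_cdf (j + N) = sup_cdf j.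
Proof.
move=> j1; apply/funext => k; have A := @cvg_walk_cdf (j + N) k (leq_trans j1 (leq_addr N j)).
have B := @cvg_walk_cdf j k j1.
by move: A; under eq_cvg do rewrite walk_cdf_period //; move=> A; apply: (cvg_unique _ A B).
Qed.

Lemma walk_sup_pmf_period j : (1 <= j)%N ->
  walk_sup_pmf X (j + N) = walk_sup_pmf X j.
Proof.
move=> j1; apply/funext => -[|k]; rewrite ?walk_sup_pmf0 ?walk_sup_pmfS //.
- by rewrite sup_cdf_period.
- by rewrite sup_cdf_period.
- exact: leq_trans (leq_addr _ _).
Qed.

(** For [j < N], the one-step relation times [H j] is [H j.+1 * g j.+1 - H j * g j], which
    telescopes to [H N * g N - H 1 * g 1]. The term [j = N], of weight 1, is [H 1 * g 1 - g N] by
    periodicity and closes the cycle. *)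
Lemma gf_cycle (s : R[i]) : `|s| <= 1 -> s != 0 ->
  (1 - s) * (\sum_(1 <= j < N.+1) s ^ lo j *
    (if j == N then 1 else \prod_(k <- N :: index_iota 1 j) atom_gf k s) *
    \sum_(0 <= u < neg_part (lo j)) s ^+ u * (conv (atom j) (sup_cdf j.+1) u)%:C) =
  gf (walk_sup_pmf X N) s * (\prod_(k <- N :: index_iota 1 N) atom_gf k s - 1).
Proof.
move=> s1 s0; pose g j := gf (walk_sup_pmf X j) s.
pose H j := \prod_(k <- N :: index_iota 1 j) atom_gf k s.
pose D j := \sum_(0 <= u < neg_part (lo j)) s ^+ u * (conv (atom j) (sup_cdf j.+1) u)%:C.
have step j : (1 <= j)%N -> (1 - s) * s ^ lo j * D j = atom_gf j s * g j.+1 - g j.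
  by move=> j1; rewrite /g (gf_walk_sup_step j1 s1 s0) subKr.
have H1 : H 1%N = atom_gf N s by rewrite /H big_cons big_geq // mulr1.
have HS j : (1 <= j)%N -> H j.+1 = H j * atom_gf j s.
  by move=> j1; rewrite /H !big_cons big_nat_recr //= mulrA.
have gN : g N.+1 = g 1%N by rewrite /g -add1n walk_sup_pmf_period.
rewrite big_nat_recr //= eqxx mulr1 mulrDr [X in _ + X]mulrA step // gN -H1.
rewrite (eq_big_nat _ _ (F2 := fun j => s ^ lo j * H j * D j)); last first.
  by move=> j /andP[_ jN]; rewrite (ltn_eqF jN).
rewrite mulr_sumr (eq_big_nat _ _ (F2 := fun j => H j.+1 * g j.+1 - H j * g j)).
  rewrite telescope_sumr //; rewrite -/(H N) -/(g N); ring.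
move=> j /andP[j1 _]; have := step j j1; rewrite HS // => E.
transitivity (H j * ((1 - s) * s ^ lo j * D j)); first by ring.
rewrite E; ring.
Qed.

(** The tail sums are nonnegative, so a single infinite one would make the expectation infinite,
    against its negativity. *)
Lemma expectation_tail : ('E_P[period_sum X N] < 0)%E ->
  exists e : nat -> R,
    (forall k, (1 <= k < N.+1)%N -> series (tail k) @ \oo --> e k) /\
    ('E_P[period_sum X N] = (\sum_(1 <= k < N.+1) ((lo k)%:~R + e k))%:E)%E.
Proof.
move=> ES; have EE := expectation_period_sum ES.
pose t k : \bar R := (\sum_(0 <= i <oo) (tail k i)%:E)%E.
have t0 k : (1 <= k)%N -> (0 <= t k)%E.
  by move=> k1; apply: nneseries_ge0 => i _ _; rewrite lee_fin tail_ge0.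
have tfin k : (1 <= k < N.+1)%N -> t k \is a fin_num.
  move=> /andP[k1 kN]; rewrite ge0_fin_numE ?t0 //.
  apply: (@le_lt_trans _ _ (\sum_(1 <= k < N.+1) t k)%E); last first.
    by rewrite ltey; apply/eqP => E; move: ES; rewrite EE E.
  rewrite (bigD1_seq k) ?iota_uniq ?mem_index_iota ?k1 //= leeDl //.
  by rewrite big_seq_cond; apply: sume_ge0 => i; rewrite mem_index_iota => /andP[/andP[/t0]].
exists (fun k => fine (t k)); split => [k k1N|].
  have : (fun n => \sum_(0 <= i < n) (tail k i)%:E)%E @ \oo --> (fine (t k))%:E.
    rewrite fineK ?tfin //; apply: is_cvg_nneseries => i _ _.
    by rewrite lee_fin tail_ge0 //; case/andP: k1N.
  under eq_cvg do rewrite sumEFin.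
  by move/fine_cvgP => [_].
rewrite EE big_split /= EFinD rmorph_sum; congr (_ + _)%E.
rewrite -sumEFin; apply: eq_big_nat => k k1N.
by rewrite fineK // tfin.
Qed.

(** The terms of a convergent tail series tend to 0, so no mass is missing. *)
Lemma cvg_series_atom1 k (e : R) : (1 <= k)%N -> series (tail k) @ \oo --> e ->
  series (atom k) @ \oo --> (1 : R).
Proof.
move=> k1 /cvgP /cvg_series_cvg_0 t0.
have tE : (fun n => 1 - tail k n) = (fun n => series (atom k) n.+1).
  by apply/funext => n; rewrite /tail subKr.
have A : 1 - tail k n @[n --> \oo] --> (1 - 0 : R).
  by apply: cvgB => //; exact: cvg_cst.
by rewrite subr0 tE (cvg_shiftS (series (atom k))) in A.
Qed.

Lemma cvg_walk_cdf1 n j : (1 <= j)%N ->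
  (forall k, (1 <= k)%N -> series (atom k) @ \oo --> (1 : R)) ->
  walk_cdf n j @ \oo --> (1 : R).
Proof.
move=> j1 a1; elim: n j j1 => [|n IH] j j1; first exact: cvg_cst.
apply: (cvg_shift_conv (atom_ge0 j) (a1 j j1) _ _ (IH j.+1 isT)) => //.
- by move=> k; exact: walk_cdf_ge0.
- exact: walk_cdf_nd.
Qed.

(* At a finite horizon the maximum has mass 1 and is monotone in the horizon, whence [L >= - E S].
   At the infinite horizon stationarity gives [L = - p * E S], with [p <= 1] the mass of the
   supremum, whence [L <= - E S]; no law of large numbers is needed. *)
Lemma overshoot_expectation : ('E_P[period_sum X N] < 0)%E ->
  (\sum_(1 <= j < N.+1)
    \sum_(0 <= u < neg_part (lo j)) conv (atom j) (sup_cdf j.+1) u)%:E =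
  (- 'E_P[period_sum X N])%E.
Proof.
move=> ES; have [e [te EE]] := expectation_tail ES.
set L := \sum_(1 <= j < N.+1) _.
set ES' := \sum_(1 <= k < N.+1) _ in EE.
rewrite EE lte_fin in ES *.
have shift (f : nat -> R) : f N.+1 = f 1%N ->
    \sum_(1 <= j < N.+1) f j.+1 = \sum_(1 <= j < N.+1) f j.
  by move=> fN; rewrite [RHS]big_ltn // [LHS]big_nat_recr //= fN [in RHS]big_add1 [LHS]addrC.
(* [te] covers one period only; other indices are reduced to it modulo [N]. *)
have a1 k : (1 <= k)%N -> series (atom k) @ \oo --> (1 : R).
  move=> k1; have per q r : atom (r.+1 + q * N) = atom r.+1.
    elim: q => [|q IH]; first by rewrite addn0.
    by rewrite mulSn [(N + _)%N]addnC addnA atom_period.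
  have -> : atom k = atom (k.-1 %% N)%N.+1.
    by rewrite -(per (k.-1 %/ N)%N) addSn addnC -divn_eq prednK.
  by apply: (cvg_series_atom1 _ (te _ _)) => //=; rewrite ltnS ltn_mod.
(* Serves twice: with [u], [v] at horizons [n], [n.+1] and [p = 1], and with both at the infinite
   horizon. [cvg_drift] compares [v j] with [u j.+1]; over a full period the latter may be replaced
   by [u j]. *)
have drift (u v : nat -> nat -> R) (p : R) :
    (forall j k, (1 <= j)%N -> 0 <= u j k) ->
    (forall j, (1 <= j)%N -> {homo u j : k l / (k <= l)%N >-> k <= l}) ->
    (forall j, (1 <= j)%N -> u j @ \oo --> p) ->
    (forall j k, (1 <= j)%N -> v j k =
      if lo j <= k%:Z then conv (atom j) (u j.+1) `|k%:Z - lo j|%N else 0) ->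
    (forall k, u N.+1 k = u 1%N k) ->
    \sum_(0 <= k < n) \sum_(1 <= j < N.+1) (u j k - v j k) @[n --> \oo] -->
    p * ES' + \sum_(1 <= j < N.+1) \sum_(0 <= k < neg_part (lo j))
      conv (atom j) (u j.+1) k.
  move=> u0 u_nd up vE uN; rewrite mulr_sumr -big_split /=.
  have E n : \sum_(0 <= k < n) \sum_(1 <= j < N.+1) (u j k - v j k) =
      \sum_(1 <= j < N.+1) \sum_(0 <= k < n) (u j.+1 k - v j k).
    rewrite exchange_big /=; under [in LHS]eq_bigr do rewrite sumrB.
    under [in RHS]eq_bigr do rewrite sumrB.
    rewrite !sumrB; congr (_ - _); apply/esym.
    by apply: (shift (fun j => \sum_(0 <= k < n) u j k)); apply: eq_bigr => k _.
  under eq_cvg do rewrite E.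
  apply: cvg_sum_nat => j jN; have /andP[j1 _] := jN.
  apply: cvg_drift => //.
  - exact: atom_ge0.
  - by move=> r; exact: series_atom_le1.
  - exact: te.
  - by move=> k; exact: u0.
  - exact: u_nd.
  - exact: up.
  - by move=> k; exact: vE.
have lower : 0 <= ES' + L.
  have D n := drift (walk_cdf n) (walk_cdf n.+1) 1
    (fun j k => @walk_cdf_ge0 n j k) (@walk_cdf_nd n)
    (fun j j1 => cvg_walk_cdf1 n j1 a1) (fun j k _ => erefl)
    (fun k => @walk_cdf_period n 1 k isT).
  (* A longer horizon lowers the distribution function, so all partial sums in [D n] are
     nonnegative, and so is their limit. *)
  have D0 n : 0 <= ES' + \sum_(1 <= j < N.+1) \sum_(0 <= k < neg_part (lo j))
      conv (atom j) (walk_cdf n j.+1) k.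
    rewrite -[ES']mul1r; apply: (cvgr_to_ge (D n)) => //; apply: nearW => K.
    apply: sumr_ge0 => k _; rewrite big_nat; apply: sumr_ge0 => j /andP[j1 _].
    by rewrite subr_ge0 walk_cdf_nincr.
  have LL : ES' + \sum_(1 <= j < N.+1) \sum_(0 <= k < neg_part (lo j))
      conv (atom j) (walk_cdf n j.+1) k @[n --> \oo] --> ES' + L.
    apply: cvgD; first exact: cvg_cst.
    apply: cvg_sum_nat => j _; apply: cvg_sum_nat => k _.
    apply: cvg_sum_nat => l _; apply: cvgM; first exact: cvg_cst.
    exact: cvg_walk_cdf.
  by apply: (cvgr_to_ge LL) => //; exact: nearW.
have sup_cvg j : cvgn (sup_cdf j).
  apply: nondecreasing_is_cvgn; first exact: sup_cdf_nd.
  by exists 1 => _ [k _ <-]; exact: sup_cdf_le1.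
pose p := limn (sup_cdf 1).
(* A single finite step does not change whether the supremum is finite, so [p] is common to all
   starting indices. *)
have sup_p j : (1 <= j)%N -> sup_cdf j @ \oo --> p.
  case: j => // j _; elim: j => [|j IH]; first exact: sup_cvg.
  have A : sup_cdf j.+1 @ \oo --> limn (sup_cdf j.+2).
    apply: (cvg_shift_conv (atom_ge0 _) (a1 j.+1 isT) _ _ (sup_cvg _)).
    - exact: sup_cdf_ge0.
    - exact: sup_cdf_nd.
    - by move=> k; exact: sup_cdfE.
  by rewrite (cvg_unique _ IH A) //; exact: sup_cvg.
have p1 : p <= 1.
  by apply: limr_le; [exact: sup_cvg|apply: nearW => k; exact: sup_cdf_le1].
have upper : p * ES' + L = 0.
  have D := drift sup_cdf sup_cdf p (fun j k _ => sup_cdf_ge0 j k)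
    (fun j _ => @sup_cdf_nd j) sup_p (fun j k => @sup_cdfE j k)
    (fun k => congr1 (fun f => f k) (@sup_cdf_period 1 isT)).
  apply: cvg_unique D _ => //; apply: cvg_near_cst; apply: nearW => K.
  by rewrite big1 // => k _; rewrite big1 // => j _; rewrite subrr.
rewrite -EFinN; congr (_%:E).
(* By [upper], [ES' + L = (1 - p) * ES'], which is at most 0; by [lower] it is at least 0. *)
have : 0 <= (1 - p) * - ES' by rewrite mulr_ge0 ?subr_ge0 // oppr_ge0 ltW.
lra.
Qed.

End Periodic.
End WalkLaw.

(** * Both identities, from bounds given on one period only *)

Theorem lemma1 (d : measure_display) (T : measurableType d) (R : realType)
    (P : probability T R) (N : nat) (X : nat -> {RV P >-> R}) (m : nat -> int)
    (N_gt0 : (0 < N)%N)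
    (X_int : forall (k : nat) (t : T), (1 <= k)%N -> X k t \is a Num.int)
    (X_indep : mutually_independent [set k : nat | (1 <= k)%N] X)
    (X_period : forall k : nat, (1 <= k)%N ->
      same_distribution (X k) (X (k + N)%N))
    (m_atom : forall j : nat, (1 <= j <= N)%N ->
      (0 < P [set t | X j t = (m j)%:~R])%E)
    (m_lower : forall j : nat, (1 <= j <= N)%N ->
      P [set t | (m j)%:~R <= X j t] = 1%E)
    (m_sum : \sum_(1 <= j < N.+1) m j < 0)
    (ES_lt0 : ('E_P[period_sum X N] < 0)%E) :
  (forall s : R[i], `|s| <= 1 -> s != 0 ->
    (1 - s) * (\sum_(1 <= j < N.+1)
      s ^ (m j) * pgf_prefix X N m j s *
      \sum_(0 <= i < neg_part (m j))
        (pi_succ X N j i)%:C *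
        \sum_(0 <= r < neg_part (m j) - i)
          s ^+ (r + i) * (cdf_at (X j) (m j + r%:Z))%:C)
    = pgf P 0 (walk_sup X N) s *
      (pgf P (\sum_(1 <= j < N.+1) m j) (fun t => (period_sum X N t)%:E) s - 1))
  /\
  (\sum_(1 <= j < N.+1)
     \sum_(0 <= i < neg_part (m j))
       pi_succ X N j i *
       \sum_(0 <= r < neg_part (m j) - i)
         cdf_at (X j) (m j + r%:Z))%:E
  = (- 'E_P[period_sum X N])%E.
Proof.
(* The periodic extension of [m] from [1, ..., N]; the predecessor makes [N], not 0, the
   representative of its class. *)
pose lo k := m (k.-1 %% N)%N.+1.
have loE k : (1 <= k <= N)%N -> lo k = m k.
  by case: k => // k /andP[_ kN]; rewrite /lo /= modn_small.
have lo_period k : (1 <= k)%N -> lo (k + N)%N = lo k.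
  by case: k => // k _; rewrite /lo addSn /= modnDr.
have law_rep k : (1 <= k)%N -> same_distribution (X (k.-1 %% N)%N.+1) (X k).
  move=> k1 A mA; rewrite -{2}(prednK k1) {2}(divn_eq k.-1 N).
  elim: (k.-1 %/ N)%N => [|q IH]; first by rewrite mul0n add0n.
  by rewrite IH mulSn -addnA [(N + _)%N]addnC -addSn; exact: X_period.
have X_lo k : (1 <= k)%N -> P [set t | (lo k)%:~R <= X k t] = 1%E.
  move=> k1; have kN : (1 <= (k.-1 %% N).+1 <= N)%N by rewrite ltn_mod.
  have E j : [set t | (lo k)%:~R <= X j t] = X j @^-1` `[(lo k)%:~R, +oo[.
    by apply/seteqP; split=> t /=; rewrite in_itv /= andbT.
  rewrite E -[LHS]/(distribution P (X k) _) -law_rep //.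
  by rewrite /distribution /pushforward -E m_lower.
have atom_period k : (1 <= k)%N -> atom X lo (k + N) = atom X lo k.
  move=> k1; apply/funext => l; rewrite /atom lo_period //.
  rewrite /pr; congr fine; apply/esym; exact: (X_period _ k1 _ (measurable_set1 _)).
(* By periodicity the wrap-around convention agrees with the law of the supremum started at
   [N.+1]. *)
have pi_succE j i : (1 <= j)%N -> pi_succ X N j i = walk_sup_pmf X j.+1 i.
  move=> j1; rewrite /pi_succ; case: eqP => // ->.
  by rewrite -[N.+1]add1n (walk_sup_pmf_period X_int X_indep X_lo).
have sum_lo j : (j <= N)%N ->
    \sum_(k <- N :: index_iota 1 j) lo k = m N + \sum_(1 <= k < j) m k.
  move=> jN; rewrite big_cons loE ?N_gt0 ?leqnn //; congr (_ + _).
  apply: eq_big_nat => k /andP[k1 kj]; rewrite loE // k1.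
  exact: leq_trans (ltnW kj) jN.
(* The case [j = N] is included, as it gives the generating function of [S_N]. *)
have prefixE j s : (j <= N)%N -> `|s| <= 1 -> s != 0 ->
    pgf P (m N + \sum_(1 <= k < j) m k)
      (fun t => (X N t + \sum_(1 <= k < j) X k t)%:E) s =
    \prod_(k <- N :: index_iota 1 j) atom_gf X lo k s.
  move=> jN s1 s0; rewrite -(pgf_sum X_int X_indep X_lo) //.
  - rewrite sum_lo //; congr pgf; apply/funext => t.
    by rewrite big_cons.
  - by rewrite /= iota_uniq andbT mem_index_iota [(N < j)%N]ltnNge jN andbF.
  - by rewrite /= N_gt0; apply/allP => k; rewrite mem_index_iota => /andP[].
split=> [s s1 s0|].
  have <- : \prod_(k <- N :: index_iota 1 N) atom_gf X lo k s =
      pgf P (\sum_(1 <= j < N.+1) m j) (fun t => (period_sum X N t)%:E) s.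
    rewrite -prefixE //; congr pgf; first by rewrite big_nat_recr // addrC.
    by apply/funext => t; rewrite /period_sum big_nat_recr //= addrC.
  rewrite (pgf_walk_sup X_int N_gt0 s1 s0).
  rewrite -(gf_cycle X_int X_indep X_lo N_gt0 lo_period atom_period s1 s0).
  congr (_ * _); apply: eq_big_nat => j /andP[j1 jN].
  rewrite -(overshoot_complex X_int X_lo) // loE ?j1 //.
  congr (_ * _ * _).
    by rewrite /pgf_prefix; case: eqP => // _; exact: prefixE.
  by apply: eq_bigr => i _; rewrite pi_succE.
rewrite -(overshoot_expectation X_int X_indep X_lo N_gt0 lo_period atom_period ES_lt0).
congr (_%:E); apply: eq_big_nat => j /andP[j1 jN].
rewrite -(overshoot_real X_int X_lo) // loE ?j1 //.
by apply: eq_bigr => i _; rewrite pi_succE.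
Qed.
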